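(* Let $\mathbb{A} = S^1\times[0,1]$ with $S^1=\mathbb{R}/\mathbb{Z}$, and let $R:\mathbb{A}\to\mathbb{A}$ be the involution $R(x,y)=(-x,y)$. Let $f:\mathbb{A}\to\mathbb{A}$ be a homeomorphism that satisfies the twist condition and is reversible, i.e. $f^{-1}=R\circ f\circ R$. Then $f$ has at least one fixed point in $\mathbb{A}$.
   Context: The covering space of $\mathbb{A}$ is $\widetilde{\mathbb{A}} = \mathbb{R} \times [0,1]$, with covering map $\pi(x,y) = (x \bmod 1, y)$. A lift of $f$ is a homeomorphism $\widetilde{f}:\widetilde{\mathbb{A}}\to\widetilde{\mathbb{A}}$ with $\pi\circ\widetilde{f}=f\circ\pi$. Twist condition: $f$ has a lift $\widetilde{f}$ that moves the two boundary components of $\widetilde{\mathbb{A}}$ in opposite directions, in the following sense: $\widetilde{f}(x,1) = (x+r_1(x),1)$ and $\widetilde{f}(x,0) = (x-r_0(x),0)$ for all $x\in\mathbb{R}$, where $r_0(x)>0$ and $r_1(x) >0$ for all $x$. *)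

(* Defs.v *)
From HB Require Import structures.
From mathcomp Require Import all_boot all_order all_algebra.
From mathcomp Require Import generic_quotient ring_quotient.
From mathcomp Require Import all_classical all_reals all_analysis.
Import Order.TTheory GRing.Theory Num.Theory.
Import numFieldNormedType.Exports.

Set Implicit Arguments.
Unset Strict Implicit.
Unset Printing Implicit Defensive.

Local Open Scope classical_set_scope.
Local Open Scope ring_scope.
Local Open Scope quotient_scope.

(* The predicate underlying Num.int, seen as an additive subgroup of R. *)
Definition integers (R : realType) : zmodClosed R :=
  GRing.ZmodClosed.clone R (@Num.int_num_subdef R) _.

(* R / Z with the quotient topology. *)
Definition circle (R : realType) : Type :=
  quotient_topology (Quotient.quot (integers R)).

HB.instance Definition _ (R : realType) := Quotient.on (circle R).
HB.instance Definition _ (R : realType) := Topological.on (circle R).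

(* The group structure is rebuilt from the operations of Quotient.quot, rather
   than copied, so that it shares the choiceType of the topological structure. *)
HB.instance Definition _ (R : realType) :=
  GRing.isZmodule.Build (circle R)
    (@Quotient.addqA R (integers R)) (@Quotient.addqC R (integers R))
    (@Quotient.add0q R (integers R)) (@Quotient.addNq R (integers R)).

(* The inverse is a field so that f^-1 can be mentioned; it is determined by
   the underlying function. *)
Record homeo (X Y : topologicalType) := Homeo {
  homeo_fun :> X -> Y;
  homeo_inv : Y -> X;
  homeo_funK : cancel homeo_fun homeo_inv;
  homeo_invK : cancel homeo_inv homeo_fun;
  homeo_fun_continuous : continuous homeo_fun;
  homeo_inv_continuous : continuous homeo_inv
}.

Definition unit_interval (R : realType) : topologicalType :=
  set_type (`[0, 1]%classic : set R).

Section annulus.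
Variable R : realType.

Definition annulus : topologicalType := (circle R * unit_interval R)%type.

Definition strip : topologicalType := (R * unit_interval R)%type.

Lemma zero_in_itv : (0 : R) \in (`[0, 1]%classic : set R).
Proof. by rewrite inE /= in_itv /= lexx ler01. Qed.

Lemma one_in_itv : (1 : R) \in (`[0, 1]%classic : set R).
Proof. by rewrite inE /= in_itv /= lexx ler01. Qed.

Definition unit_zero : unit_interval R := exist _ 0 zero_in_itv.
Definition unit_one : unit_interval R := exist _ 1 one_in_itv.

(* \pi_(circle R) x is the class of x modulo 1. *)
Definition covering (z : strip) : annulus := (\pi_(circle R) z.1, z.2).

Definition reflection (z : annulus) : annulus := (- z.1, z.2).

Definition is_lift (F : homeo strip strip) (f : annulus -> annulus) : Prop :=
  covering \o F =1 f \o covering.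

Definition twist (f : annulus -> annulus) : Prop :=
  exists F : homeo strip strip, is_lift F f /\
  exists r0 r1 : R -> R,
    [/\ forall x, 0 < r0 x,
        forall x, 0 < r1 x,
        forall x, F (x, unit_one) = (x + r1 x, unit_one) &
        forall x, F (x, unit_zero) = (x - r0 x, unit_zero)].

Definition reversible (f : homeo annulus annulus) : Prop :=
  homeo_inv f =1 reflection \o f \o reflection.

End annulus.

(* Main.v *)
Require Import Defs.
From mathcomp Require Import all_boot all_order all_algebra.
From mathcomp Require Import generic_quotient ring_quotient.
From mathcomp Require Import all_classical all_reals all_analysis.
From mathcomp Require Import lra.
Import Order.TTheory GRing.Theory Num.Theory.
Import numFieldNormedType.Exports.
Set Implicit Arguments.
Unset Strict Implicit.
Unset Printing Implicit Defensive.
Local Open Scope classical_set_scope.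
Local Open Scope ring_scope.
Local Open Scope quotient_scope.

(** Let F be the lift given by the twist condition, let S (x, y) = (-x, y), and
    put W = S o F.  Reversibility says that W o W covers the identity, so it is
    a horizontal translation by a constant k; on the line y = 1 the map W is
    a continuous g with g x < -x, and such a g must have a fixed point if g o g
    is a translation ([square_translation]), so k = 0 and W is an involution.

    Consider the displacement V z = F z - z.  From F (W z) = S z it follows
    that V (W z) is the reflection of V z in the horizontal axis.  If F had no
    fixed point, V would be a nowhere vanishing field on the simply connected
    strip, pointing left on the bottom line and right on the top line.  Let a be
    a vertical segment from bottom to top.  The segment a and its image W o a
    both join bottom to top, and the straight-line homotopy between them
    keeps the ends on the boundary lines; hence V turns by the same amount
    along both.  But the reflection reverses the turning, so this amount is its
    own opposite, whereas it is an odd multiple of pi.  Thus F has a fixed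
    point, and its projection is fixed by f.

    The turning number is only needed modulo 2: no angle is lifted, and one
    counts instead how often V crosses the positive vertical axis along a fine
    subdivision ([crossings]).  This parity is a homotopy invariant
    ([crossings_homotopy]), while V and its reflection together cross the
    whole vertical axis an odd number of times ([crossings_conjugate]). *)

(** * Parity of the crossings of a vertical ray *)

Section Crossing.
Variable R : realType.
Implicit Types (u v w : R * R) (p q : R * R).

Definition dot u v : R := u.1 * v.1 + u.2 * v.2.

Definition conjugate u : R * R := (u.1, - u.2).

(** For 0 < dot u v, this tells whether the short turn from u to v passes
    through the positive vertical axis: if the first coordinates have opposite
    signs, the second ones share their sign.  The axis itself is counted on the
    right-hand side. *)
Definition crossing u v : bool :=
  ((0 <= u.1) (+) (0 <= v.1)) && (0 < u.2).

Lemma opposite_sides_same_height u v : 0 < dot u v -> (0 <= u.1) (+) (0 <= v.1) ->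
  u.2 != 0 /\ (0 < v.2) = (0 < u.2).
Proof.
rewrite /dot => uv0 s; have uv1 : u.1 * v.1 <= 0.
  by move: s; case: (leP 0 u.1) => ?; case: (leP 0 v.1) => ? // _; nra.
have {uv0 uv1} uv2 : 0 < u.2 * v.2 by lra.
split; first by apply: contraTneq uv2 => ->; rewrite mul0r ltxx.
by case: (ltP 0 u.2) => ?; case: (ltP 0 v.2) => ? //; exfalso; nra.
Qed.

(** Three vectors at pairwise acute angles lie in an open half-plane, so the
    turns between them do not wind around the origin. *)
Lemma crossing_triangle u v w :
  0 < dot u v -> 0 < dot v w -> 0 < dot u w ->
  crossing u v (+) crossing v w = crossing u w.
Proof.
move=> /opposite_sides_same_height uv /opposite_sides_same_height vw.
move=> /opposite_sides_same_height uw; move: uv vw uw.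
rewrite /crossing; case: (0 <= u.1); case: (0 <= v.1); case: (0 <= w.1) => //=;
  move=> uv vw uw; rewrite ?addbF//.
- by rewrite -(vw isT).2 (uw isT).2.
- by rewrite (uv isT).2 addbb.
- by rewrite (uv isT).2 addbb.
- by rewrite -(vw isT).2 (uw isT).2.
Qed.

(** A vector and its conjugate together see every crossing of the vertical axis:
    one of them at the upper half, the other at the lower half. *)
Lemma crossing_conjugate u v : 0 < dot u v ->
  crossing u v (+) crossing (conjugate u) (conjugate v)
    = (0 <= u.1) (+) (0 <= v.1).
Proof.
move=> /opposite_sides_same_height; rewrite /crossing /=.
case: addb => //= /(_ isT)[u0 _].
by rewrite oppr_gt0; case: ltgtP u0.
Qed.

Definition crossings (g : nat -> R * R) (n : nat) : bool :=
  \big[addb/false]_(j < n) crossing (g j) (g j.+1).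

Lemma crossings_conjugate (g : nat -> R * R) n :
  (forall j, 0 < dot (g j) (g j.+1)) ->
  crossings g n (+) crossings (conjugate \o g) n
    = (0 <= (g 0%N).1) (+) (0 <= (g n).1).
Proof.
rewrite /crossings => hg; elim: n => [|n IH]; first by rewrite !big_ord0 !addbb.
rewrite !big_ord_recr /= addbACA IH crossing_conjugate//.
by rewrite addbA addbK.
Qed.

(** Each quadrilateral g j, g (j+1), h (j+1), h j is cut by its diagonal into two
    triangles. *)
Lemma crossings_rows (g h : nat -> R * R) n :
  (forall j, 0 < dot (g j) (g j.+1)) -> (forall j, 0 < dot (h j) (h j.+1)) ->
  (forall j, 0 < dot (g j) (h j)) -> (forall j, 0 < dot (g j) (h j.+1)) ->
  crossings g n (+) crossing (g n) (h n)
    = crossing (g 0%N) (h 0%N) (+) crossings h n.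
Proof.
rewrite /crossings => gg hh gh gh1.
elim: n => [|n IH]; first by rewrite !big_ord0 addbF.
rewrite !big_ord_recr /= -addbA crossing_triangle// addbA -IH -addbA.
by rewrite crossing_triangle.
Qed.

(** The columns 0 and n of the grid stay on one side of the vertical axis, so they
    contribute no crossing and all rows have the same parity. *)
Lemma crossings_homotopy (g : nat -> nat -> R * R) m n :
  (forall i j, 0 < dot (g i j) (g i j.+1)) ->
  (forall i j, 0 < dot (g i j) (g i.+1 j)) ->
  (forall i j, 0 < dot (g i j) (g i.+1 j.+1)) ->
  (forall i, 0 <= (g i n).1) -> (forall i, (g i 0%N).1 < 0) ->
  crossings (g 0%N) n = crossings (g m) n.
Proof.
move=> h1 h2 h3 gn g0; elim: m => // m ->.
have := crossings_rows n (h1 m) (h1 m.+1) (h2 m) (h3 m).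
by rewrite /crossing !gn !leNgt !g0 addbb addbF.
Qed.

Lemma dot_gt0 u : u != 0 -> 0 < dot u u.
Proof.
case: u => a b; rewrite -pair_eqE /dot /= -!expr2 negb_and lt0r => ab.
by rewrite addr_ge0 ?sqr_ge0// paddr_eq0 ?sqr_ge0// !sqrf_eq0 negb_and ab.
Qed.

(** By compactness a nonvanishing field turns by an acute angle only, over all
    sufficiently small steps starting in the unit square. *)
Lemma acute_mesh (H : R * R -> R * R) : continuous H -> (forall z, H z != 0) ->
  exists N : nat, forall p q, p.1 \in `[0, 1] -> p.2 \in `[0, 1] ->
    `|p.1 - q.1| <= N.+1%:R^-1 -> `|p.2 - q.2| <= N.+1%:R^-1 ->
    0 < dot (H p) (H q).
Proof.
move=> cH H0.
have cK : compact (`[0, 1]%classic `*` `[0, 1]%classic : set (R * R)).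
  by apply: compact_setX; exact: segment_compact.
move/compact_near_coveringP: cK.
pose P (n : nat) (p : R * R) := forall q,
  `|p.1 - q.1| <= n.+1%:R^-1 -> `|p.2 - q.2| <= n.+1%:R^-1 ->
    0 < dot (H p) (H q).
move=> /(_ nat \oo P _)[x _|N _ hN]; last first.
  by exists N => p q p1 p2; apply: hN => //=.
have : continuous (fun pq : (R * R) * (R * R) => dot (H pq.1) (H pq.2)).
  move=> pq; rewrite /dot.
  have c1 : {for pq, continuous (fun pq : (R * R) * (R * R) => H pq.1)}.
    by apply: continuous_comp; [exact: cvg_fst|exact: cH].
  have c2 : {for pq, continuous (fun pq : (R * R) * (R * R) => H pq.2)}.
    by apply: continuous_comp; [exact: cvg_snd|exact: cH].
  apply: cvgD; apply: cvgM.
  - by apply: (continuous_comp c1); exact: cvg_fst.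
  - by apply: (continuous_comp c2); exact: cvg_fst.
  - by apply: (continuous_comp c1); exact: cvg_snd.
  - by apply: (continuous_comp c2); exact: cvg_snd.
move=> /(_ (x, x)) /cvgr_gt /(_ 0) /=.
have -> : 0 < dot (H x) (H x).
  by rewrite dot_gt0.
move=> /(_ isT) [[A B]] /= [/nbhs_ballP[e /= e0 eA] /nbhs_ballP[d /= d0 dB]] AB.
(* A point within k of x moved by at most k stays within d of x. *)
pose k := Num.min e d / 2.
have k0 : 0 < k by rewrite divr_gt0// lt_min e0.
have [ke kd] : k < e /\ k + k <= d.
  by rewrite /k; case: (ltP e d) => ?; split; lra.
have Hk : \forall i \near \oo, (i.+1%:R^-1 : R) < k
  by exact: near_infty_natSinv_lt (PosNum k0).
exists (ball x k, [set n | n.+1%:R^-1 < k]) => /=.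
  by split => //; exact: nbhsx_ballx.
move=> [p n] /= [[xp1 xp2] nk] q pq1 pq2; apply: (AB (p, q)); split => /=.
  by apply: eA; split; apply: le_ball (ltW ke) _ _.
apply: dB; apply: le_ball kd _ _; split; apply: ball_triangle.
- exact: xp1.
- exact: le_lt_trans pq1 nk.
- exact: xp2.
- exact: le_lt_trans pq2 nk.
Qed.
(** The edges H (0, .) and H (1, .) have equal parities by homotopy, whereas a
    path from the left to the right half-plane and its conjugate have different ones. *)
Lemma no_conjugating_homotopy (H : R * R -> R * R) :
  continuous H -> (forall z, H z != 0) ->
  (forall r, (H (r, 0)).1 < 0) -> (forall r, 0 <= (H (r, 1)).1) ->
  ~ (forall s, H (1, s) = conjugate (H (0, s))).
Proof.
move=> cH H0 Hl Hr Hc.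
have [N hN] := acute_mesh cH H0.
(* Truncating at 1 makes the grid estimates hold for all indices. *)
pose t i : R := Num.min (i%:R / N.+1%:R) 1.
have N0 : 0 < N.+1%:R^-1 :> R by rewrite invr_gt0 ltr0n.
have t0 : t 0 = 0 by rewrite /t mul0r; apply/min_idPl.
have t1 : t N.+1 = 1 by rewrite /t divff ?minxx// pnatr_eq0.
have t01 i : t i \in `[0, 1].
  by rewrite in_itv /= le_min ler01 mulr_ge0 ?ler0n ?(ltW N0)//= ge_min lexx orbT.
have tS i : `|t i - t i.+1| <= N.+1%:R^-1.
  rewrite /t -[i.+1%:R]natr1 mulrDl mul1r; move: N.+1%:R^-1 N0 => b b0.
  move: (i%:R * b) => a.
  by rewrite ler_norml /Num.min; case: ltP => ?; case: ltP => ?; lra.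
have tt i : `|t i - t i| <= N.+1%:R^-1 by rewrite subrr normr0 ltW.
pose g i j := H (t i, t j).
have row0 j : 0 < dot (g 0 j) (g 0 j.+1) by apply: hN; rewrite ?t01 ?tt ?tS.
have := @crossings_conjugate (g 0%N) N.+1 row0.
have -> : conjugate \o g 0%N = g N.+1.
  by apply/funext => j; rewrite /g /= t0 t1 Hc.
rewrite -(@crossings_homotopy g N.+1 N.+1).
- by rewrite addbb /g t0 t1 Hr leNgt Hl.
- by move=> i j; apply: hN; rewrite ?t01 ?tt ?tS.
- by move=> i j; apply: hN; rewrite ?t01 ?tt ?tS.
- by move=> i j; apply: hN; rewrite ?t01 ?tt ?tS.
- by move=> i; rewrite /g t1.
- by move=> i; rewrite /g t0.
Qed.

End Crossing.

(** * The strip and its covering map *)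

Lemma continuous_pairing (T U V : topologicalType) (f : T -> U) (g : T -> V) :
  continuous f -> continuous g -> continuous (fun t => (f t, g t)).
Proof. by move=> cf cg t; apply: cvg_pair; [exact: cf|exact: cg]. Qed.

Lemma continuous_after (T U V : topologicalType) (f : T -> U) (g : U -> V) :
  continuous f -> continuous g -> continuous (fun t => g (f t)).
Proof. by move=> cf cg t; apply: continuous_comp; [exact: cf|exact: cg]. Qed.

Lemma continuous_fst (U V : topologicalType) : continuous (@fst U V).
Proof. by move=> z; exact: cvg_fst. Qed.

Lemma continuous_snd (U V : topologicalType) : continuous (@snd U V).
Proof. by move=> z; exact: cvg_snd. Qed.

Section Strip.
Variable R : realType.
Implicit Types (z : strip R).

Lemma int_valued_constant (h : R -> R) :
  continuous h -> (forall t, h t \is a Num.int) -> h 0 = h 1.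
Proof.
move=> ch hint.
have gap (x y : R) : x \is a Num.int -> y \is a Num.int -> x < y -> x + 1 <= y.
  move=> /intrP[m ->] /intrP[n ->].
  by rewrite ltr_int -lezD1 -(ler_int R) intrD.
have step : h 0 != h 1 -> exists v, [/\ v \is a Num.int,
    Num.min (h 0) (h 1) < v & v < Num.min (h 0) (h 1) + 1].
  move=> h01.
  have [|t _ ht] := @IVT R h 0 1 (Num.min (h 0) (h 1) + 2^-1) ler01
    (continuous_subspaceT ch).
    move: h01; rewrite /Num.min /Num.max.
    by case: ltgtP => // /(gap _ _ (hint _) (hint _)) ? _; lra.
  by exists (h t); rewrite hint ht; split => //; lra.
apply/eqP; case: eqVneq => // /step[v [vint mv vm]].
have : Num.min (h 0) (h 1) + 1 <= v by apply: gap => //; rewrite /Num.min; case: ifP.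
by rewrite leNgt vm.
Qed.

Definition mirror z : strip R := (- z.1, z.2).

Lemma clamp_itv (t : R) : Num.max 0 (Num.min t 1) \in (`[0, 1]%classic : set R).
Proof.
by rewrite inE /= in_itv /= le_max lexx ge_max ler01 ge_min lexx orbT.
Qed.

(** The retraction of the line onto the interval, used to write maps of the strip
    as maps defined on the whole plane. *)
Definition clamp (t : R) : unit_interval R :=
  exist _ (Num.max 0 (Num.min t 1)) (clamp_itv t).

Lemma clampK : cancel val clamp.
Proof.
move=> y; apply: val_inj => /=; have := valP y.
rewrite inE /= in_itv /= => /andP[y0 y1].
by rewrite min_l// max_r.
Qed.

Lemma clamp0 : clamp 0 = unit_zero R.
Proof. exact: (clampK (unit_zero R)). Qed.

Lemma clamp1 : clamp 1 = unit_one R.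
Proof. exact: (clampK (unit_one R)). Qed.

Lemma val_continuous : continuous (val : unit_interval R -> R).
Proof. exact: initial_continuous. Qed.

Lemma clamp_continuous : continuous clamp.
Proof.
apply: continuous_comp_initial => t.
apply: (@continuous_max R R^o (fun=> 0) (fun t => Num.min t 1)).
  exact: cvg_cst.
by apply: (@continuous_min R R^o id (fun=> 1)); [exact: cvg_id|exact: cvg_cst].
Qed.

Lemma pi_eq_int (x y : R) :
  \pi_(circle R) x = \pi_(circle R) y -> x - y \is a Num.int.
Proof.
move=> h.
have : x - y \in integers R by rewrite (Quotient.idealrBE (integers R)); apply/eqP.
by [].
Qed.

Lemma covering_mirror z : covering (mirror z) = reflection (covering z).
Proof.
by congr pair; exact: (@Quotient.pi_opp R (integers R)).
Qed.

Lemma mirror_continuous : continuous mirror.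
Proof.
apply: continuous_pairing; last exact: continuous_snd.
by move=> z; apply: cvgN; exact: cvg_fst.
Qed.

(** The strip is connected, and the difference of the first coordinates of W z
    and z is an integer depending continuously on z. *)
Lemma deck_translation (W : strip R -> strip R) : continuous W ->
  (forall z, covering (W z) = covering z) ->
  exists k, forall z, W z = (z.1 + k, z.2).
Proof.
move=> cW hW.
exists (W (0, unit_one R)).1 => z.
have [W1 W2] : (W z).1 - z.1 = (W (0, unit_one R)).1 /\ (W z).2 = z.2.
  split; last by case: (hW z).
  (* The segment from (0, 1) to z. *)
  pose p t : strip R := (t * z.1, clamp (t * val z.2 + (1 - t))).
  have cp : continuous p.
    apply: continuous_pairing.
      by move=> t; apply: cvgM; [exact: cvg_id|exact: cvg_cst].
    apply: continuous_after clamp_continuous => t.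
    apply: cvgD; first by apply: cvgM; [exact: cvg_id|exact: cvg_cst].
    by apply: cvgB; [exact: cvg_cst|exact: cvg_id].
  have := @int_valued_constant (fun t => (W (p t)).1 - (p t).1).
  have -> : p 0 = (0, unit_one R) by rewrite /p !mul0r add0r subr0 clamp1.
  have -> : p 1 = z by rewrite /p !mul1r subrr addr0 clampK; case: (z).
  rewrite subr0 => <- //.
  - move=> t; apply: cvgB; last exact: (continuous_after cp (@continuous_fst _ _)).
    exact: (continuous_after (continuous_after cp cW) (@continuous_fst _ _)).
  - by move=> t; apply: pi_eq_int; case: (hW (p t)).
by rewrite [LHS]surjective_pairing W2 -W1 addrC subrK.
Qed.

(** It suffices that g has a fixed point.  As g 0 < 0, the intermediate value theorem
    gives one unless g x < x for all x; but then x + k = g (g x) < g x < -x for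
    all x, which fails for large x. *)
Lemma square_translation (g : R -> R) (k : R) : continuous g ->
  (forall x, g x < - x) -> (forall x, g (g x) = x + k) -> k = 0.
Proof.
move=> cg gl gg.
have [a [a0 ga]] : exists a, a <= 0 /\ a <= g a.
  apply: contrapT => /forallNP na.
  have gn x : x <= 0 -> g x < x.
    by move=> x0; rewrite ltNge; apply/negP => xg; apply: (na x).
  have gn' x : g x < x by case: (leP x 0) => [/gn//|?]; have := gl x; lra.
  have := gg `|k|; have := gn' (g `|k|); have := gl `|k|.
  by have := ler_norm (- k); have := normr_ge0 k; rewrite normrN; lra.
have cd : continuous (fun x => g x - x).
  by move=> x; apply: cvgB; [exact: cg|exact: cvg_id].
have [|c _ hc] := @IVT R (fun x => g x - x) a 0 0 a0 (continuous_subspaceT cd).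
  have := gl 0; rewrite /= oppr0 ge_min le_max subr_ge0 ga !addr0.
  by move=> /ltW ->; rewrite orbT.
by move/subr0_eq: hc => hc; have := gg c; rewrite !hc; lra.
Qed.

(** * The displacement of a reversible lift *)

Definition displacement (F : strip R -> strip R) z : R * R :=
  ((F z).1 - z.1, val (F z).2 - val z.2).

Lemma displacement_continuous F : continuous F -> continuous (displacement F).
Proof.
move=> cF; have cy := continuous_after (@continuous_snd R _) val_continuous.
apply: continuous_pairing => z; apply: cvgB.
- exact: (continuous_after cF (@continuous_fst _ _)).
- exact: cvg_fst.
- exact: (continuous_after cF cy).
- exact: cy.
Qed.

Lemma displacement_eq0 F z : displacement F z = 0 -> F z = z.
Proof.
move=> [/subr0_eq h1 /subr0_eq/val_inj h2].
by rewrite [LHS]surjective_pairing h1 h2; case: (z).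
Qed.

(** Put w = mirror (F z).  The hypothesis says that F w = mirror z, so
    F w - w = mirror z - mirror (F z), which is the displacement of z with its
    vertical part reversed. *)
Lemma displacement_mirror F z : mirror (F (mirror (F z))) = z ->
  displacement F (mirror (F z)) = conjugate (displacement F z).
Proof.
rewrite /displacement /conjugate => h.
have -> : F (mirror (F z)) = mirror z.
  by rewrite -{2}h /mirror /= opprK; case: (F _).
by rewrite /= opprB opprK addrC.
Qed.

(** Without fixed points, the displacement along the straight-line homotopy from
    the vertical segment a to its image under mirror o F would contradict
    [no_conjugating_homotopy]. *)
Lemma reversible_lift_fixpoint (F : strip R -> strip R) (r0 r1 : R -> R) :
  continuous F -> (forall z, mirror (F (mirror (F z))) = z) ->
  (forall x, 0 < r0 x) -> (forall x, 0 < r1 x) ->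
  (forall x, F (x, unit_one R) = (x + r1 x, unit_one R)) ->
  (forall x, F (x, unit_zero R) = (x - r0 x, unit_zero R)) ->
  exists z, F z = z.
Proof.
move=> cF FF r0P r1P F1 F0; apply: contrapT => /forallNP nF.
pose W z := mirror (F z).
have cW : continuous W := continuous_after cF mirror_continuous.
pose a s : strip R := (0, clamp s).
have ca : continuous a.
  by apply: continuous_pairing clamp_continuous => s; exact: cvg_cst.
pose P (q : R * R) : strip R := (q.1 * (W (a q.2)).1,
  clamp ((1 - q.1) * val (clamp q.2) + q.1 * val (W (a q.2)).2)).
have cP : continuous P.
  have cs := @continuous_snd R R.
  have cWa := continuous_after (continuous_after cs ca) cW.
  apply: continuous_pairing => [q|].
    apply: cvgM; first exact: cvg_fst.
    exact: (continuous_after cWa (@continuous_fst _ _)).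
  apply: continuous_after clamp_continuous => q.
  apply: cvgD; apply: cvgM.
  - by apply: cvgB; [exact: cvg_cst|exact: cvg_fst].
  - exact: (continuous_after
      (continuous_after cs clamp_continuous) val_continuous).
  - exact: cvg_fst.
  - exact: (continuous_after
      (continuous_after cWa (@continuous_snd R (unit_interval R))) val_continuous).
apply: (@no_conjugating_homotopy R (displacement F \o P)).
- exact: continuous_after cP (displacement_continuous cF).
- by move=> q; apply/eqP => /displacement_eq0 /nF.
- move=> r; rewrite /P /= /a /W clamp0 F0 /= min_l// maxxx !mulr0 addr0 clamp0 F0 /=.
  by have := r0P (r * - (0 - r0 0)); lra.
- move=> r; rewrite /P /= /a /W clamp1 F1 /= minxx max_r// !mulr1 subrK clamp1 F1 /=.
  by have := r1P (r * - (0 + r1 0)); lra.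
- move=> s.
  have P0 : P (0, s) = a s.
    rewrite /P /= !mul0r subr0 mul1r addr0.
    by congr pair; exact: (clampK (clamp s)).
  have P1 : P (1, s) = W (a s).
    by rewrite /P /= mul1r subrr mul0r add0r mul1r clampK.
  by rewrite /= P0 P1 displacement_mirror.
Qed.

(** The reversibility of f lifts without a translation term; the twist at the top
    boundary is what excludes it. *)
Lemma lift_reversible (f : homeo (annulus R) (annulus R))
    (F : homeo (strip R) (strip R)) (r1 : R -> R) :
  is_lift F f -> reversible f -> (forall x, 0 < r1 x) ->
  (forall x, F (x, unit_one R) = (x + r1 x, unit_one R)) ->
  forall z, mirror (F (mirror (F z))) = z.
Proof.
move=> Ff rf r1P F1.
have cF := @homeo_fun_continuous _ _ F.
pose W z := mirror (F z).
have cW : continuous W := continuous_after cF mirror_continuous.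
have [||k hk] := @deck_translation (W \o W).
- exact: (continuous_after cW cW).
- move=> z; rewrite /W /= !covering_mirror.
  have lift w : covering (F w) = f (covering w) := Ff w.
  by rewrite lift covering_mirror lift -[RHS](homeo_funK f (covering z)) rf.
suff k0 : k = 0 by move=> z; rewrite -/(W _) -/(W _) [LHS]hk k0 addr0; case: (z).
pose g x := (W (x, unit_one R)).1.
have gE x : W (x, unit_one R) = (g x, unit_one R) by rewrite /g /W F1.
apply: (@square_translation g).
- apply: continuous_after (@continuous_fst _ _); apply: continuous_after cW.
  by apply: continuous_pairing => x; [exact: cvg_id|exact: cvg_cst].
- by move=> x; rewrite /g /W F1 /=; have := r1P x; lra.
- by move=> x; rewrite {1}/g -gE -[W (W _)]/((W \o W) _) hk.
Qed.

End Strip.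

Theorem mainTheorem2 (R : realType) (f : homeo (annulus R) (annulus R)) :
  twist f -> reversible f -> exists z : annulus R, f z = z.
Proof.
move=> [F [Ff [r0 [r1 [r0P r1P F1 F0]]]]] rf.
have [z Fz] := reversible_lift_fixpoint (@homeo_fun_continuous _ _ F)
  (lift_reversible Ff rf r1P F1) r0P r1P F1 F0.
by exists (covering z); have := Ff z; rewrite /= Fz.
Qed.
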